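(* Let $\mathcal{D}=(\Omega,\mathcal{B})$ be a supersimple $2$-$(n,4,\lambda)$ design with $n>2\lambda+2$, and let $\mathcal{C}$ denote the set of all collinear triples of elements of $\Omega$. Let $\infty\in\Omega$ and define $G:=\mathcal{L}_\infty(\mathcal{D})$. Then: (a) if $G$ is a group, then $G$ is primitive on $\Omega$; (b) if $(\Omega,\mathcal{C})$ is a regular two-graph, then $\pi_\infty(\mathcal{D})$ is transitive on $\Omega\setminus\{\infty\}$; (c) if $(\Omega,\mathcal{C})$ is a regular two-graph and $G$ is a group, then $\pi_\infty(\mathcal{D})$ is primitive on $\Omega\setminus\{\infty\}$.
   Context: A $2$-$(n,4,\lambda)$ design $(\Omega,\mathcal{B})$ consists of a set $\Omega$ of $n$ points and a multiset $\mathcal{B}$ of $4$-subsets of $\Omega$ (lines) such that every $2$-subset of $\Omega$ lies in exactly $\lambda$ lines; it is supersimple if any two distinct lines meet in at most two points. For distinct $a,b\in\Omega$ there are $\lambda$ lines $\{a,b,a_i,b_i\}$ ($1\le i\le\lambda$) through $a,b$, and the points $a_1,\dots,a_\lambda,b_1,\dots,b_\lambda$ are pairwise distinct; the elementary move is $[a,b]:=(a,b)\prod_{i=1}^{\lambda}(a_i,b_i)\in\operatorname{Sym}(\Omega)$, and $[a,a]:=1$. Permutations act on the right and products are composed left to right. For $a_0,\dots,a_k\in\Omega$ the move sequence is $[a_0,a_1,\dots,a_k]:=[a_0,a_1][a_1,a_2]\cdots[a_{k-1},a_k]$. For $\infty\in\Omega$, $\mathcal{L}_\infty(\mathcal{D})$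 is the set of all move sequences $[\infty,a_1,\dots,a_k]$ ($k\ge1$) starting at $\infty$ (the Conway groupoid), and $\pi_\infty(\mathcal{D})$ is the set of all move sequences $[\infty,a_1,\dots,a_{k-1},\infty]$ starting and ending at $\infty$ (a subgroup of $\operatorname{Sym}(\Omega\setminus\{\infty\})$). A collinear triple is a $3$-subset of $\Omega$ contained in some line. A $2$-$(n,3,\mu)$ design $(\Omega,\mathcal{C})$ is a regular two-graph if every $4$-subset of $\Omega$ contains exactly $0$, $2$ or $4$ of the members of $\mathcal{C}$. *)

(* Defs.v *)
From mathcomp Require Import all_boot all_fingroup.
From mathcomp Require Import primitive_action.
From mathcomp Require boolp.
Set Implicit Arguments. Unset Strict Implicit. Unset Printing Implicit Defensive.
Local Open Scope group_scope.

Section Designs.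
Variable T : finType.

(* A 2-(n,4,lam) design on the point set T (n = #|T|): the lines form a
   multiset, represented as a sequence of 4-subsets of T. *)
Definition is_2design4 (blocks : seq {set T}) (lam : nat) : Prop :=
  (forall B, B \in blocks -> #|B| = 4) /\
  (forall a b : T, a != b -> count (fun B : {set T} => (a \in B) && (b \in B)) blocks = lam).

(* supersimple: any two distinct lines (distinct members of the multiset)
   meet in at most two points *)
Definition supersimple (blocks : seq {set T}) : Prop :=
  forall i j, i < size blocks -> j < size blocks -> i != j ->
    #|nth set0 blocks i :&: nth set0 blocks j| <= 2.

Definition other_pair_perm (L : {set T}) (a b : T) : {perm T} :=
  let S := L :\ a :\ b in
  match [pick x in S] with
  | Some x => match [pick y in S :\ x] with
              | Some y => tperm x y
              | None => 1
              end
  | None => 1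
  end.

(* elementary move [a,b] = (a,b) * prod_i (a_i,b_i); [a,a] = 1.
   In mathcomp, (s * t) x = t (s x): products are composed left to right. *)
Definition elem_move (blocks : seq {set T}) (a b : T) : {perm T} :=
  if a == b then 1 else
  tperm a b * \prod_(L <- blocks | (a \in L) && (b \in L)) other_pair_perm L a b.

Fixpoint move_seq (blocks : seq {set T}) (a0 : T) (s : seq T) : {perm T} :=
  match s with
  | [::] => 1
  | a1 :: s' => elem_move blocks a0 a1 * move_seq blocks a1 s'
  end.

Definition conway_groupoid (blocks : seq {set T}) (inf : T) : {set {perm T}} :=
  [set g : {perm T} | boolp.asbool (exists s : seq T, 0 < size s /\ g = move_seq blocks inf s)].

Definition pi_inf (blocks : seq {set T}) (inf : T) : {set {perm T}} :=
  [set g : {perm T} | boolp.asbool (exists s : seq T, g = move_seq blocks inf (rcons s inf))].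

Definition is_group_set (G : {set {perm T}}) : Prop :=
  (1 \in G) /\ (forall g h, g \in G -> h \in G -> g * h \in G) /\
  (forall g, g \in G -> g^-1 \in G).

Definition collinear_triples (blocks : seq {set T}) : {set {set T}} :=
  [set X : {set T} | (#|X| == 3) && has (fun B : {set T} => X \subset B) blocks].

Definition regular_two_graph (C : {set {set T}}) : Prop :=
  (forall X, X \in C -> #|X| = 3) /\
  (exists mu : nat, forall a b : T, a != b ->
      #|[set X in C | (a \in X) && (b \in X)]| = mu) /\
  (forall Y : {set T}, #|Y| = 4 ->
      #|[set X in C | X \subset Y]| \in [:: 0; 2; 4]).
End Designs.

(* Main.v *)
Require Import Defs.
From mathcomp Require Import all_boot all_fingroup.
From mathcomp Require Import primitive_action.
From mathcomp Require boolp.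
Local Open Scope group_scope.

(* Write f for the indicator function of the collinear triples; f(a, b, x) = 1
   exactly when [a,b] moves x and x is not a or b, so every elementary move has
   n - 2 lam - 2 > 0 fixed points.
   (a) G is a group containing all elementary moves.  Given a block system with
   d, e in a block D, the move [d,e] only fixes points of D other than d.  Take a
   outside D and b fixed by [d,a]; then a, b and d lie in distinct blocks and
   [a,b] fixes D pointwise, so it has more fixed points than [d,e].
   (b) If f(oo, x, y) = 0 then [oo,x,y,oo] maps x to y.  If the graph of such
   pairs had no edge leaving a proper subset X, then counting the triples on x in
   X and y not in X by the two-graph parity condition would force n = 2 lam + 2.
   (c) Given a block system, (b) provides a, b in distinct blocks with
   f(oo, a, b) = 0.  For c in the block of a, f(oo, a, c) = 0, as otherwise the
   parity condition makes [a,c] fixed-point-free.  With c' the image of c under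
   [a,b], the loop [oo,a,c',oo] fixes c' and maps b to c, although c' and b are
   in the same block while b and c are not. *)

(** * Block systems as invariant equivalence relations *)

Lemma imprimitivity_congruence (T : finType) (A : {set {perm T}}) (S : {set T})
    (Q : {set {set T}}) :
  imprimitivity_system A S 'P Q ->
  exists h : T -> {set T},
    [/\ forall g x y, g \in A -> x \in S -> y \in S -> h x = h y ->
          h (g x) = h (g y),
        exists d e, [/\ d \in S, e \in S, d != e & h d = h e] &
        forall x, x \in S -> exists2 y, y \in S & h y != h x].
Proof.
(* [pblock Q] sends a point to its block, so equality of its values is the equivalence relation of
   the block system. *)
case/and3P=> partQ actQ /andP[Q_gt1 ltQS]; exists (pblock Q).
have [/eqP covQ tiQ nzQ] := and3P partQ; split.
- move=> g x y Ag Sx Sy hxy.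
  have Qx : pblock Q x \in Q by rewrite pblock_mem ?covQ.
  have QgX : ('P^*)%act (pblock Q x) g \in Q by rewrite (acts_act actQ).
  have im z : z \in pblock Q x -> pblock Q (g z) = ('P^*)%act (pblock Q x) g.
    by move=> Xz; apply: def_pblock => //; apply: imset_f.
  by rewrite !im // ?mem_pblock ?covQ // hxy mem_pblock covQ.
- have /dinjectivePn[d Sd [e /andP[/= ned Se] hde]] : ~~ dinjectiveb (pblock Q) S.
    (* If every block were a single point, [Q] would have at least as many members as [S]. *)
    apply: contraL ltQS => /dinjectiveP inj_h; rewrite -leqNgt.
    rewrite -(card_in_imset inj_h) subset_leq_card //.
    by apply/subsetP=> _ /imsetP[x Sx ->]; rewrite pblock_mem ?covQ.
  by exists d, e; rewrite eq_sym.
- move=> x Sx; have Qx : pblock Q x \in Q by rewrite pblock_mem ?covQ.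
  have /set0Pn[B /setD1P[neB QB]] : Q :\ pblock Q x != set0.
    by rewrite -card_gt0; move: Q_gt1; rewrite (cardsD1 (pblock Q x)) Qx.
  have /set0Pn[y By] : B != set0 by apply: contraNneq nzQ => <-.
  exists y; last by rewrite (def_pblock tiQ QB By).
  by rewrite -covQ; apply/bigcupP; exists B.
Qed.

(** * The transposition that a line contributes to a move *)

Lemma uniq4 (T : eqType) (a b c d : T) :
  uniq [:: a; b; c; d] =
  [&& a != b, a != c, a != d, b != c & (b != d) && (c != d)].
Proof. by rewrite /= !inE !negb_or andbT -!andbA. Qed.

(** Removing [a] and [b] from a line leaves exactly two points, so both picks succeed and the
    default value [1] never arises. *)
Lemma other_pairE (T : finType) (L : {set T}) a b :
  #|L| = 4 -> a != b -> a \in L -> b \in L ->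
  exists x y, [/\ x != y, L :\ a :\ b = [set x; y] &
                  other_pair_perm L a b = tperm x y].
Proof.
move=> cL ab La Lb.
have c2 : #|L :\ a :\ b| = 2.
  move: cL; rewrite (cardsD1 a) (cardsD1 b (L :\ a)) La !inE eq_sym ab Lb.
  by case.
rewrite /other_pair_perm; case: pickP => [u Su|/eq_card0 c0]; last first.
  by rewrite c0 in c2.
have : #|L :\ a :\ b :\ u| = 1%N.
  by move: c2; rewrite (cardsD1 u) Su => -[].
move/eqP/cards1P=> [v def_v]; exists u, v.
have Sv : v \in L :\ a :\ b :\ u by rewrite def_v set11.
split.
- by have /setD1P[] := Sv; rewrite eq_sym.
- by rewrite -def_v setD1K.
case: pickP => [w|/(_ v)]; last by rewrite Sv.
by rewrite def_v inE => /eqP->.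
Qed.

Lemma other_pair_out (T : finType) (L : {set T}) a b z :
  #|L| = 4 -> a != b -> a \in L -> b \in L ->
  [|| z == a, z == b | z \notin L] -> other_pair_perm L a b z = z.
Proof.
move=> cL ab La Lb; have [x [y [_ def_S ->]]] := other_pairE T L a b cL ab La Lb.
move=> out; have : z \notin L :\ a :\ b.
  by rewrite !inE; case: (z == b) out => //; case: (z == a).
by rewrite def_S !inE negb_or ![z == _]eq_sym => /andP[nx ny]; rewrite tpermD.
Qed.

Lemma other_pair_in (T : finType) (L : {set T}) a b x y :
  #|L| = 4 -> a != b -> a \in L -> b \in L ->
  x != y -> x \in L :\ a :\ b -> y \in L :\ a :\ b ->
  other_pair_perm L a b x = y.
Proof.
move=> cL ab La Lb; have [u [v [_ -> ->]]] := other_pairE T L a b cL ab La Lb.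
move=> xy; rewrite !inE => /orP[] /eqP xE /orP[] /eqP yE; subst x y;
  by rewrite ?eqxx ?tpermL ?tpermR // in xy *.
Qed.

Lemma perm_prod_fix (T : finType) (I : eqType) (r : seq I) (P : pred I)
    (F : I -> {perm T}) z :
  (forall i, i \in r -> P i -> F i z = z) -> (\prod_(i <- r | P i) F i) z = z.
Proof.
rewrite big_seq_cond => fixz; elim/big_ind: _; first by rewrite perm1.
  by move=> s t sz tz; rewrite permM sz.
by move=> i /andP[ri Pi]; apply: fixz.
Qed.

(** * Collinear triples and the parity condition of a two-graph *)

Section Designs.
Variables (T : finType) (blocks : seq {set T}).

(** False as soon as two of the points coincide, because the set then has fewer than three
    elements. *)
Definition collinear (x y z : T) : bool :=
  [set x; y; z] \in collinear_triples blocks.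

Lemma collinearP x y z :
  reflect ([/\ x != y, x != z & y != z] /\
           exists2 L, L \in blocks & [/\ x \in L, y \in L & z \in L])
          (collinear x y z).
Proof.
rewrite /collinear inE setUC cardsU1 cards2 !inE negb_or ![z == _]eq_sym.
have sub3 (L : {set T}) :
    z |: [set x; y] \subset L = [&& x \in L, y \in L & z \in L].
  by rewrite !subUset !sub1set andbC andbA.
apply: (iffP andP) => [[D /hasP[L bL]]|[[-> -> ->] [L bL [Lx Ly Lz]]]].
  rewrite sub3 => /and3P[Lx Ly Lz]; split; last by exists L.
  by move: D; do 3 case: (_ != _).
by split=> //; apply/hasP; exists L => //; rewrite sub3 Lx Ly.
Qed.

Lemma collinearC x y z : collinear x y z = collinear y x z.
Proof. by rewrite /collinear [[set x; y]]setUC. Qed.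

Lemma collinearCr x y z : collinear x y z = collinear x z y.
Proof. by rewrite /collinear -!setUA [[set y; z]]setUC. Qed.

Lemma collinear_rot x y z : collinear x y z = collinear y z x.
Proof. by rewrite collinearC collinearCr. Qed.

(** The values 0, 2 and 4 are all even, so the indicators of the four triples inside a 4-set sum to
    0 modulo 2. *)
Lemma regular_two_graph_parity w x y z :
  regular_two_graph (collinear_triples blocks) -> uniq [:: w; x; y; z] ->
  collinear x y z (+) collinear w y z (+) collinear w x z (+) collinear w x y
    = false.
Proof.
case=> card3 [_ even4] U; pose Y : {set T} := [set u in [:: w; x; y; z]].
have cY : #|Y| = 4 by rewrite cardsE (card_uniqP U).
pose C := collinear_triples blocks.
have card4 : #|[set X in C | X \subset Y]| = \sum_(u in Y) (Y :\ u \in C).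
  (* A triple inside [Y] is [Y] with one point removed, and distinct removed points give distinct
     triples. *)
  have -> : [set X in C | X \subset Y]
          = (fun u => Y :\ u) @: [set u in Y | Y :\ u \in C].
    apply/setP=> X; apply/setIdP/imsetP=> [[CX sXY]|[u /setIdP[Yu CYu] ->]].
      have cX := card3 X CX.
      have /eqP/cards1P[u def_u] : #|Y :\: X| = 1%N.
        by rewrite cardsD (setIidPr sXY) cY cX.
      have def_X : X = Y :\ u by rewrite -def_u setDDr setDv set0U (setIidPr sXY).
      have /setDP[Yu _] : u \in Y :\: X by rewrite def_u set11.
      by exists u; rewrite // inE Yu -def_X.
    by split=> //; apply: subsetDl.
  rewrite card_in_imset => [|u v /setIdP[Yu _] /setIdP[Yv _] /setP/(_ u)].
    by rewrite -sum1dep_card big_mkcondr /=; apply: eq_bigr => u _; case: ifP.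
  by rewrite !in_setD1 eqxx Yu /= andbT => /esym/negbFE/eqP.
have := U; rewrite uniq4 => /and5P[wx wy wz xy /andP[xz yz]].
have := even4 Y cY; rewrite -/C card4.
have -> : \sum_(u in Y) (Y :\ u \in C) = \sum_(u <- [:: w; x; y; z]) (Y :\ u \in C).
  by rewrite [RHS]big_uniq //; apply: eq_bigl => u; rewrite inE.
rewrite !big_cons big_nil.
have -> : Y :\ w = [set x; y; z].
  apply/setP=> v; rewrite !inE; have [->|] := eqVneq v w; last by rewrite /= orbA.
  by rewrite (negPf wx) (negPf wy) (negPf wz).
have -> : Y :\ x = [set w; y; z].
  apply/setP=> v; rewrite !inE; have [->|] := eqVneq v x; last by rewrite /= orbA.
  by rewrite eq_sym (negPf wx) (negPf xy) (negPf xz).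
have -> : Y :\ y = [set w; x; z].
  apply/setP=> v; rewrite !inE; have [->|] := eqVneq v y; last by rewrite /= orbA.
  by rewrite ![y == _]eq_sym (negPf wy) (negPf xy) eq_sym (negPf yz).
have -> : Y :\ z = [set w; x; y].
  apply/setP=> v; rewrite !inE; have [->|] := eqVneq v z; last by rewrite /= orbF orbA.
  by rewrite ![z == _]eq_sym (negPf wz) (negPf xz) (negPf yz).
by rewrite /collinear -/C; do 4 case: (_ \in C).
Qed.

(** * Elementary moves of a supersimple design *)

Variable lam : nat.
Hypothesis design : is_2design4 blocks lam.
Hypothesis ss : supersimple blocks.

Local Notation move := (elem_move blocks).

(** A repeated line would meet its second copy in four points. *)
Lemma supersimple_uniq : uniq blocks.
Proof.
apply/(uniqP set0) => i j; rewrite !inE => lti ltj eq_ij.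
apply/eqP/negPn/negP=> neq_ij; have := ss i j lti ltj neq_ij.
by rewrite eq_ij setIid (proj1 design) ?mem_nth.
Qed.

Lemma supersimple_eq (K L : {set T}) x y z : K \in blocks -> L \in blocks ->
  [/\ x != y, x != z & y != z] -> [/\ x \in K, y \in K & z \in K] ->
  [/\ x \in L, y \in L & z \in L] -> K = L.
Proof.
move=> bK bL [xy xz yz] [Kx Ky Kz] [Lx Ly Lz].
apply/eqP/negPn/negP=> neKL.
have neI : index K blocks != index L blocks.
  by apply: contraNneq neKL => eqI; rewrite -(nth_index set0 bK) eqI nth_index.
have := ss _ _ _ _ neI; rewrite !index_mem bK bL !nth_index // leqNgt.
move/(_ isT isT)/negP; apply.
have <- : #|[set x; y; z]| = 3.
  by rewrite setUC cardsU1 cards2 !inE negb_or ![z == _]eq_sym xy xz yz.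
by rewrite subset_leq_card // !subUset !sub1set !inE Kx Ky Kz Lx Ly Lz.
Qed.

Lemma move_id a : move a a = 1.
Proof. by rewrite /elem_move eqxx. Qed.

Lemma move_left a b : move a b a = b.
Proof.
have [->|ab] := eqVneq a b; first by rewrite move_id perm1.
rewrite /elem_move (negPf ab) permM tpermL.
apply: perm_prod_fix => L bL /andP[La Lb].
by apply: other_pair_out; rewrite ?(proj1 design) // eqxx orbT.
Qed.

Lemma move_right a b : move a b b = a.
Proof.
have [->|ab] := eqVneq a b; first by rewrite move_id perm1.
rewrite /elem_move (negPf ab) permM tpermR.
apply: perm_prod_fix => L bL /andP[La Lb].
by apply: other_pair_out; rewrite ?(proj1 design) // eqxx.
Qed.

Lemma move_fix a b x : x != a -> x != b -> ~~ collinear a b x -> move a b x = x.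
Proof.
move=> xa xb ncol.
have [ab|ab] := eqVneq a b; first by rewrite ab move_id perm1.
rewrite /elem_move (negPf ab) permM tpermD ?[_ == x]eq_sym //.
apply: perm_prod_fix => L bL /andP[La Lb].
apply: other_pair_out; rewrite ?(proj1 design) //.
apply/or3P/Or33; apply: contra ncol => Lx; apply/collinearP.
by split; [split; rewrite // eq_sym | exists L].
Qed.

(** By supersimplicity no other line through [a] and [b] contains [x] or [y], so only the factor of
    [L] in the product acts on them. *)
Lemma move_line (L : {set T}) a b x y : L \in blocks ->
  a \in L -> b \in L -> x \in L -> y \in L -> uniq [:: a; b; x; y] ->
  move a b x = y.
Proof.
move=> bL La Lb Lx Ly; rewrite /= !inE !negb_or andbT.
case/and3P=> /and3P[ab ax ay] /andP[bx bj] xy.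
have cL K : K \in blocks -> #|K| = 4 by apply: (proj1 design).
rewrite /elem_move (negPf ab) permM tpermD //.
(* The product is split around the factor of [L]; the factors before it fix [x] and those after it
   fix [y]. *)
have [r1 [r2 def_r]] : exists r1 r2, blocks = r1 ++ L :: r2.
  by have [r1 r2] := splitPr bL; exists r1, r2.
have notL K : K \in r1 ++ r2 -> K \in blocks /\ K != L.
  move=> rK; have nL : L \notin r1 ++ r2.
    have := supersimple_uniq; rewrite def_r uniq_catC /= => /andP[nrL _].
    by rewrite mem_cat orbC -mem_cat.
  split; last by apply: contraNneq nL => <-.
  by rewrite def_r mem_cat inE orbCA -mem_cat rK orbT.
have out K z : K \in r1 ++ r2 -> (a \in K) && (b \in K) -> z \in L ->
    a != z -> b != z -> other_pair_perm K a b z = z.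
  move=> /notL[bK neK] /andP[Ka Kb] Lz az bz.
  apply: other_pair_out; rewrite ?cL //; apply/or3P/Or33.
  by apply: contra neK => Kz; apply/eqP/(supersimple_eq _ _ a b z).
rewrite def_r big_cat big_cons /= La Lb /= !permM (perm_prod_fix _ _ r1); last first.
  by move=> K rK PK; apply: out; rewrite // mem_cat rK.
rewrite (@other_pair_in T L a b x y) ?cL ?inE ?Lx ?Ly //; last first.
- by rewrite ![y == _]eq_sym ay bj.
- by rewrite ![x == _]eq_sym ax bx.
by apply: perm_prod_fix => K rK PK; apply: out; rewrite // mem_cat rK orbT.
Qed.

Lemma move_collinear a b x : collinear a b x ->
  exists2 L, L \in blocks &
    [/\ a \in L, b \in L, x \in L, move a b x \in L
      & uniq [:: a; b; x; move a b x]].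
Proof.
case/collinearP=> -[ab ax bx] [L bL [La Lb Lx]]; exists L => //.
have cS : #|[set a; b; x]| = 3.
  by rewrite setUC cardsU1 cards2 !inE negb_or ![x == _]eq_sym ab ax bx.
have sSL : [set a; b; x] \subset L by rewrite !subUset !sub1set La Lb.
have /eqP/cards1P[y def_y] : #|L :\: [set a; b; x]| = 1%N.
  by rewrite cardsD (setIidPr sSL) cS (proj1 design).
have : y \in L :\: [set a; b; x] by rewrite def_y set11.
rewrite !inE !negb_or ![y == _]eq_sym => /andP[/andP[/andP[ay yb] yx] Ly].
have U : uniq [:: a; b; x; y] by rewrite /= !inE !negb_or ab ax ay bx yb yx.
by rewrite (move_line L a b x y).
Qed.

Lemma move_neq a b x : collinear a b x -> move a b x != x.
Proof.
by case/move_collinear=> L _ [_ _ _ _] /and4P[_ _]; rewrite inE eq_sym.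
Qed.

(** Double counting of pairs of a line through [a], [b] and a further point on it: each line has two
    such points, and each point collinear with [a], [b] lies on only one such line. *)
Lemma card_collinear a b : a != b -> #|[set z | collinear a b z]| = (2 * lam)%N.
Proof.
move=> ab; rewrite -(proj2 design a b ab) -sum1_count mulnC big_distrl /=.
have E : forall L, L \in blocks -> (a \in L) && (b \in L) ->
    (1 * 2)%N = \sum_(z | (z != a) && (z != b)) (z \in L).
  move=> L bL /andP[La Lb]; rewrite mul1n.
  have := proj1 design L bL.
  rewrite (cardsD1 a) (cardsD1 b (L :\ a)) La !inE eq_sym ab Lb => -[<-].
  rewrite -sum1_card [RHS]big_mkcond [LHS]big_mkcond /=; apply: eq_bigr => z _.
  by rewrite !inE; do 3 case: (_ \in _) || case: (_ == _).
rewrite big_seq_cond (eq_bigr (fun L : {set T} =>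
    \sum_(z | (z != a) && (z != b)) (z \in L))); last first.
  by move=> L /andP[bL /(E L bL)].
rewrite -big_seq_cond exchange_big /= -sum1dep_card big_mkcond [RHS]big_mkcond /=.
apply: eq_bigr => z _; case: collinearP => [[[_ az bz] [L bL [La Lb Lz]]]|ncol].
  rewrite ![z == _]eq_sym az bz /= -big_mkcondr sum1_count.
  rewrite (_ : count _ _ = count_mem L blocks); last first.
    apply: eq_in_count => K bK; apply/andP/eqP=> [[/andP[Ka Kb] Kz]|-> //].
      exact: (supersimple_eq K L a b z).
    by rewrite La Lb.
  by rewrite count_uniq_mem ?supersimple_uniq ?bL.
case: ifP => // /andP[za zb]; rewrite big_seq_cond big1 // => L /and3P[bL La Lb].
apply/eqP; rewrite eqb0; apply/negP=> Lz; apply: ncol.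
by split; [split; rewrite // eq_sym | exists L].
Qed.

(** * Fixed points of moves, and closure of the hole stabilizer *)

Variable inf : T.
Hypothesis large : 2 * lam + 2 < #|T|.

Local Notation groupoid := (conway_groupoid blocks inf).
Local Notation hole := (pi_inf blocks inf).

(** The points moved are [a], [b] and those collinear with them. Hence all nontrivial elementary
    moves have equally many fixed points, which drives the counting in (a). *)
Lemma card_move_fixed a b : a != b ->
  #|[set x | move a b x == x]| + (2 * lam + 2) = #|T|.
Proof.
move=> ab; rewrite -(card_collinear a b ab).
have -> : 2 = #|[set a; b]| by rewrite cards2 ab.
have -> : [set x | move a b x == x] =
          ~: ([set z | collinear a b z] :|: [set a; b]).
  apply/setP=> x; rewrite !inE !negb_or.
  case: (boolP (collinear a b x)) => [/move_neq/negPf //|ncol].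
  have [->|xa] := eqVneq x a; first by rewrite move_left eq_sym (negPf ab).
  have [->|xb] := eqVneq x b; first by rewrite move_right (negPf ab).
  by rewrite move_fix ?eqxx.
have <- : #|[set z | collinear a b z] :|: [set a; b]|
          = #|[set z | collinear a b z]| + #|[set a; b]|.
  rewrite cardsU (_ : _ :&: _ = set0) ?cards0 ?subn0 //.
  apply/setP=> x; rewrite !inE; apply/negP=> /andP[/collinearP[[_ ax bx] _]].
  by rewrite ![x == _]eq_sym (negPf ax) (negPf bx).
by rewrite addnC cardsC.
Qed.

Lemma exists_noncollinear a b : a != b ->
  exists x, [/\ x != a, x != b & ~~ collinear a b x].
Proof.
move=> ab; have := card_move_fixed a b ab.
have [/eqP|[x]] := set_0Vmem [set x | move a b x == x].
  by rewrite -cards_eq0 => /eqP-> E; move: large; rewrite -E add0n ltnn.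
rewrite inE => fx _; exists x; split.
- by apply: contraTneq fx => ->; rewrite move_left eq_sym.
- by apply: contraTneq fx => ->; rewrite move_right.
by apply: contraL fx => /move_neq.
Qed.

Lemma move_seq_cat a s t :
  move_seq blocks a (s ++ t) =
    move_seq blocks a s * move_seq blocks (last a s) t.
Proof. by elim: s a => [|b s IH] a /=; rewrite ?mul1g // IH mulgA. Qed.

Lemma move_seq_last a s : move_seq blocks a s a = last a s.
Proof. by elim: s a => [|b s IH] a /=; rewrite ?perm1 // permM move_left IH. Qed.

Lemma mem_hole s : move_seq blocks inf (rcons s inf) \in hole.
Proof. by rewrite inE; apply/boolp.asboolP; exists s. Qed.

Lemma hole_inf g : g \in hole -> g inf = inf.
Proof.
by rewrite inE => /boolp.asboolP[s ->]; rewrite move_seq_last last_rcons.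
Qed.

Lemma hole1 : 1 \in hole.
Proof. by have := mem_hole [::]; rewrite /= move_id mulg1. Qed.

Lemma holeM g k : g \in hole -> k \in hole -> g * k \in hole.
Proof.
rewrite inE => /boolp.asboolP[s ->]; rewrite inE => /boolp.asboolP[t ->].
have := mem_hole (rcons s inf ++ t).
by rewrite rcons_cat move_seq_cat last_rcons.
Qed.

Definition loop (a b : T) : {perm T} := move inf a * move a b * move b inf.

Lemma loop_hole a b : loop a b \in hole.
Proof. by have := mem_hole [:: a; b]; rewrite /= mulg1 mulgA. Qed.

Lemma mem_groupoid s : s != [::] -> move_seq blocks inf s \in groupoid.
Proof.
by case: s => // a s _; rewrite inE; apply/boolp.asboolP; exists (a :: s).
Qed.

(** * Part (a): primitivity of the Conway groupoid when it is a group *)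

Section Group.
Hypothesis grp : is_group_set groupoid.

(** [a,b] is the quotient of [oo,a,b] by [oo,a]. *)
Lemma move_groupoid a b : move a b \in groupoid.
Proof.
have [_ [mulG invG]] := grp.
have Gab := mem_groupoid [:: a; b] isT; have Ga := mem_groupoid [:: a] isT.
have := mulG _ _ (invG _ Ga) Gab; rewrite /= !mulg1.
by rewrite mulgA mulVg mul1g.
Qed.

Lemma groupoid_stab g : g \in groupoid -> g inf = inf -> g \in hole.
Proof.
rewrite inE => /boolp.asboolP[s [s_gt0 ->]]; rewrite move_seq_last.
case/lastP: s s_gt0 => // s x _; rewrite last_rcons => ->; exact: mem_hole.
Qed.

Lemma groupoid_trans : [transitive groupoid, on [set: T] | 'P].
Proof.
apply/imsetP; exists inf => //; apply/setP=> x; rewrite inE; apply/esym/imsetP.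
exists (move inf x); first exact: move_groupoid.
by rewrite /= apermE move_left.
Qed.

Lemma groupoid_primitive : [primitive groupoid, on [set: T] | 'P].
Proof.
rewrite /primitive groupoid_trans /=.
apply/existsP=> -[Q /imprimitivity_congruence[h [hG [d [e [_ _ de hde]]] hT]]].
have hmove a b x y : h x = h y -> h (move a b x) = h (move a b y).
  by apply: hG; rewrite ?in_setT // move_groupoid.
have [a _ had] := hT d (in_setT _).
have da : d != a by apply: contraNneq had => ->.
have [b [bd ba nb]] := exists_noncollinear d a da.
have fix_b : move d a b = b by apply: move_fix.
(* If [b] were in the block of [d], then [d,a], which fixes [b], would keep that block, yet it sends
   [d] to [a]. The argument for [hba] is the same. *)
have hbd : h b != h d.
  apply: contraNneq had => hbd.
  by have := hmove d a _ _ hbd; rewrite fix_b move_left hbd => <-.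
have hba : h b != h a.
  apply: contraNneq hbd => hba.
  by have := hmove d a _ _ hba; rewrite fix_b move_right => ->.
have fix_d : move a b d = d.
  apply: move_fix; rewrite // 1?eq_sym //; rewrite -collinear_rot //.
pose B := [set x | h x == h d].
have sB : B \subset [set x | move a b x == x].
  apply/subsetP=> x; rewrite !inE => /eqP hx; apply/negPn/negP=> mx.
  have col : collinear a b x.
    apply: contraR mx => ncol; rewrite move_fix //.
      by apply: contraNneq had => <-; rewrite hx.
    by apply: contraNneq hbd => <-; rewrite hx.
  (* If [a,b] moved [x] in [B] to [y], then [y] would be in [B] too, since [a,b] fixes [d]. But
     [x,a] sends [x] to [a] and [y] to [b], which lie in distinct blocks. *)
  have [L bL [La Lb Lx Ly U]] := move_collinear _ _ _ col.
  have hy : h (move a b x) = h x by rewrite (hmove a b _ _ hx) fix_d.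
  have : h (move x a (move a b x)) = h (move x a x) by apply: hmove.
  rewrite move_left (move_line L x a _ b) //; last first.
    move: U; rewrite !uniq4 => /and5P[ab' ax ay bx /andP[by_ xy]].
    by rewrite [x == a]eq_sym ax xy [x == b]eq_sym bx ay ab' [_ == b]eq_sym by_.
  by move/eqP; rewrite (negPf hba).
have sF : [set x | move d e x == x] \subset B :\ d.
  apply/subsetP=> x; rewrite !inE => fx; apply/andP; split.
    by apply: contraTneq fx => ->; rewrite move_left eq_sym.
  apply: contraTT fx => hx.
  have xd : x != d by apply: contraNneq hx => ->.
  (* For [x] outside [B], the move [d,x] carries [d] out of [B], so it cannot fix [e]. *)
  have col : collinear d x e.
    apply: contraR (hx) => ncol; have ee : move d x e = e.
      apply: move_fix; rewrite // eq_sym //.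
      by apply: contraNneq hx => ->; rewrite hde.
    by have := hmove d x _ _ hde; rewrite ee move_left hde => ->.
  by apply: move_neq; rewrite collinearCr.
have ab : a != b by rewrite eq_sym.
have eqF : #|[set x | move a b x == x]| = #|[set x | move d e x == x]|.
  by apply/eqP; rewrite -(eqn_add2r (2 * lam + 2)) !card_move_fixed.
have := subset_leq_card sB; rewrite eqF leqNgt => /negP; apply.
apply: leq_ltn_trans (subset_leq_card sF) _.
by rewrite [in ltnRHS](cardsD1 d) inE eqxx.
Qed.
End Group.

(** * Part (b): transitivity of the hole stabilizer for a regular two-graph *)

Section TwoGraph.
Hypothesis tg : regular_two_graph (collinear_triples blocks).

(** The two-graph is recovered from the graph on the points other than [inf] whose edges are the
    pairs collinear with [inf]. *)
Lemma parity_inf x y z : x != inf -> y != inf -> z != inf ->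
  x != y -> x != z -> y != z ->
  collinear x y z =
    collinear inf y z (+) collinear inf x z (+) collinear inf x y.
Proof.
move=> xi yi zi xy xz yz.
have := regular_two_graph_parity inf x y z tg.
rewrite uniq4 ![inf == _]eq_sym xi yi zi xy xz yz => /(_ isT).
by do 4 case: (collinear _ _ _).
Qed.

Lemma noncollinear_crossing (X : {set T}) x0 y0 :
  inf \notin X -> x0 \in X -> y0 \notin X -> y0 != inf ->
  exists x y, [/\ x \in X, y \notin X, y != inf & ~~ collinear inf x y].
Proof.
move=> Xi Xx0 Xy0 y0i.
case: (boolP [exists x in X, exists y in ~: X,
                (y != inf) && ~~ collinear inf x y]).
  case/exists_inP=> x Xx /exists_inP[y]; rewrite inE => Xy /andP[yi ncol].
  by exists x, y.
move/exists_inPn=> all_col.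
have col x y : x \in X -> y \notin X -> y != inf -> collinear inf x y.
  move=> Xx Xy yi; have /exists_inPn/(_ y) := all_col x Xx.
  by rewrite inE Xy yi negbK; apply.
have x0i : x0 != inf by apply: contraNneq Xi => <-.
have xy0 : x0 != y0 by apply: contraNneq Xy0 => <-.
(* [N u] is the neighbourhood of [u] in the graph at [inf], where by assumption every point of [X]
   is joined to every point outside [X] other than [inf]. *)
pose N u := [set z | collinear inf u z].
have cN u : u != inf -> #|N u| = (2 * lam)%N.
  by move=> ui; apply: card_collinear; rewrite eq_sym.
have self u v : collinear inf u v -> (u != v) && (inf != v).
  by case/collinearP=> -[_ -> ->].
have union : N x0 :|: N y0 = [set~ inf].
  apply/setP=> z; rewrite !inE; have [->|zi] := eqVneq z inf.
    by apply/negbTE/norP; split; apply/negP=> /self; rewrite eqxx andbF.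
  case: (boolP (z \in X)) => Xz; last by rewrite col.
  by rewrite orbC collinearCr col.
(* Each [z] is joined to [x0] or to [y0], so parity makes it collinear with [x0], [y0] exactly when
   it is joined to both. *)
have inter : [set z | collinear x0 y0 z] = inf |: (N x0 :&: N y0).
  apply/setP=> z; rewrite !inE; have [->|zi] := eqVneq z inf.
    by rewrite -collinear_rot col.
  have [->|zx] := eqVneq z x0.
    apply/idP/idP=> [/collinearP[[_]]|/andP[/self]]; by rewrite eqxx.
  have [->|zy] := eqVneq z y0.
    apply/idP/idP=> [/collinearP[[_ _]]|/andP[_ /self]]; by rewrite eqxx.
  rewrite parity_inf // 1?eq_sym //.
  rewrite (col x0 y0) // addbT /=; case: (boolP (z \in X)) => Xz.
    by rewrite [collinear inf y0 z]collinearCr (col z y0) //; case: collinear.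
  by rewrite (col x0 z) //; case: collinear.
have := cardsUI (N x0) (N y0); rewrite union !cN //.
have : #|[set z | collinear x0 y0 z]| = (2 * lam)%N.
  exact: card_collinear.
rewrite inter cardsU1 !inE (_ : collinear inf x0 inf = false); last first.
  by apply/negP=> /self; rewrite eqxx andbF.
move: large; rewrite -[#|T|](cardsC [set inf]) cards1 /=.
set I := #|_ :&: _|; set n := #|~: _|.
(* Here [n] is one less than the number of points: [I + 1 = 2 * lam] and [n + I = 4 * lam], against
   [large]. *)
move=> lt E1 E2; have En : n = 2 * lam + 1.
  by apply/eqP; rewrite -(eqn_add2r I) E2 -addnA E1.
by rewrite En addnCA ltnn in lt.
Qed.

(** The point [a] goes to [inf], stays there under [a,b], and then goes to [b]. *)
Lemma loop_noncollinear a b : a != inf -> b != inf ->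
  ~~ collinear inf a b -> loop a b a = b.
Proof.
move=> ai bi ncol; have [<-|ab] := eqVneq a b.
  by rewrite /loop move_id mulg1 permM move_right move_right.
rewrite /loop !permM move_right [move a b inf]move_fix ?move_right // 1?eq_sym //.
by rewrite -collinear_rot.
Qed.

Lemma hole_trans : [transitive hole, on [set~ inf] | 'P].
Proof.
have [x0 x0i] : exists x0, x0 != inf.
  have /set0Pn[x] : [set~ inf] != set0.
    by rewrite -card_gt0 cardsC1 -subn1 subn_gt0 (leq_trans _ large) // addn2.
  by rewrite !inE; exists x.
apply/imsetP; exists x0; rewrite ?inE //.
pose X := orbit 'P hole x0; rewrite -/X.
have X_inf : inf \notin X.
  apply/orbitP=> -[g hg /= E]; move: x0i; rewrite -(inj_eq (@perm_inj _ g)).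
  by rewrite hole_inf // -E eqxx.
have Xx0 : x0 \in X by apply/orbitP; exists 1; rewrite ?hole1 //= apermE perm1.
apply/eqP; rewrite eqEsubset andbC; apply/andP; split.
  by apply/subsetP=> x Xx; rewrite !inE; apply: contraNneq X_inf => <-.
apply/subsetP=> y0; rewrite !inE => y0i; apply/negPn/negP=> Xy0.
(* A noncollinear pair leaving the orbit gives a loop that leads out of it. *)
have [x [y [Xx Xy yi ncol]]] := noncollinear_crossing X x0 y0 X_inf Xx0 Xy0 y0i.
case/negP: Xy; have /orbitP[g hg /= gx] := Xx; apply/orbitP.
exists (g * loop x y); first by rewrite holeM ?loop_hole.
move: gx; rewrite /= !apermE permM => ->; rewrite loop_noncollinear //.
by apply: contraNneq X_inf => <-.
Qed.

(** * Part (c): primitivity of the hole stabilizer *)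

Section Group.
Hypothesis grp : is_group_set groupoid.

Lemma move_hole a b : a != inf -> b != inf -> ~~ collinear inf a b ->
  move a b \in hole.
Proof.
move=> ai bi ncol; apply: groupoid_stab; first exact: move_groupoid.
by apply: move_fix; rewrite 1?eq_sym // -collinear_rot.
Qed.

Section Congruence.
Variable h : T -> {set T}.
Hypothesis h_hole : forall g x y, g \in hole -> x != inf -> y != inf ->
  h x = h y -> h (g x) = h (g y).

(** Otherwise [a,b] would lie in the hole stabilizer and fix [c], while moving [a] from the block of
    [c] to that of [b]. *)
Lemma congruence_collinear a b c : a != inf -> b != inf -> c != inf ->
  h a != h b -> h c = h a -> c != a -> ~~ collinear inf a b -> collinear a b c.
Proof.
move=> ai bi ci hab hca ca ncol; apply: contraR hab => ncol2.
have cb : move a b c = c -> h a == h b.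
  move=> fc; have := h_hole _ _ _ (move_hole a b ai bi ncol) ci ai hca.
  by rewrite fc move_left hca => ->.
have [E|cb'] := eqVneq c b; first by rewrite -hca E.
by apply/cb/move_fix.
Qed.

Lemma congruence_noncollinear a b c : a != inf -> b != inf -> c != inf ->
  h a != h b -> h c = h a -> c != a -> ~~ collinear inf a b ->
  ~~ collinear inf a c.
Proof.
move=> ai bi ci hab hca ca ncol; apply/negP=> iac.
have ac : a != c by rewrite eq_sym.
(* It remains to show that every [x] is collinear with [a], [c], contrary to this choice. By parity
   this means that [x] is joined in the graph at [inf] to both or neither of them. *)
have [x [xa xc]] := exists_noncollinear a c ac; case/negP.
have [->|xi] := eqVneq x inf; first by rewrite -collinear_rot.
have hbc : h c != h b by rewrite hca.
have bx u v : h u != h v -> u != v by move=> huv; apply: contraNneq huv => ->.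
have ab := bx _ _ hab; have cb := bx _ _ hbc.
have abc := congruence_collinear a b c ai bi ci hab hca ca ncol.
have ncol_cb : ~~ collinear inf c b.
  move: abc; rewrite parity_inf // 1?eq_sym // iac (negPf ncol).
  by rewrite collinearCr; case: (collinear _ _ _).
rewrite parity_inf // 1?eq_sym // iac addbT.
(* Inside the block, [x] is compared with [a] and with [c] through [b]; outside it, a missing edge
   from [x] to [a] or [c] gives the collinearity directly. *)
have [hx|hx] := eqVneq (h x) (h a).
  have xb : x != b by apply: bx; rewrite hx.
  have abx := congruence_collinear a b x ai bi xi hab hx xa ncol.
  have hxc : h x = h c by rewrite hca.
  have cbx := congruence_collinear c b x ci bi xi hbc hxc xc ncol_cb.
  move: abx cbx; rewrite (parity_inf a b x) ?(parity_inf c b x) // 1?eq_sym //.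
  rewrite (negPf ncol) (negPf ncol_cb).
  by do 3 case: (collinear _ _ _).
have col_out u v : u != inf -> v != inf -> h v = h u -> v != u -> h u != h x ->
    ~~ collinear inf u x -> collinear u x v.
  by move=> *; apply: congruence_collinear.
have hax : h a != h x by rewrite eq_sym.
have hcx : h c != h x by rewrite hca.
case: (boolP (collinear inf a x)) => iax; last first.
  have := col_out a c ai ci hca ca hax iax.
  rewrite collinearCr (parity_inf a c x) // 1?eq_sym // iac (negPf iax).
  by case: collinear.
case: (boolP (collinear inf c x)) => icx //.
have := col_out c a ci ai (esym hca) ac hcx icx.
rewrite collinearCr collinearC (parity_inf a c x) // 1?eq_sym // iac iax.
by rewrite (negPf icx).
Qed.
End Congruence.

Lemma hole_primitive : [primitive hole, on [set~ inf] | 'P].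
Proof.
rewrite /primitive hole_trans /=.
apply/existsP=> -[Q /imprimitivity_congruence[h [hS [d [e [di ei de hde]]] hT]]].
have hH g x y : g \in hole -> x != inf -> y != inf ->
    h x = h y -> h (g x) = h (g y).
  by move=> hg xi yi; apply: hS; rewrite ?in_setC1.
have [y0 y0i hy0] := hT d di; rewrite !inE in di ei y0i.
pose X := [set x | (x != inf) && (h x == h d)].
have [||||a [b [Xa Xb bi nab]]] := noncollinear_crossing X d y0.
- by rewrite !inE eqxx.
- by rewrite !inE di eqxx.
- by rewrite !inE y0i.
- by [].
move: Xa Xb; rewrite !inE bi /= => /andP[ai /eqP had] hbd.
have [c [ci hca ca]] : exists c, [/\ c != inf, h c = h a & c != a].
  have [->|ad] := eqVneq a d; first by exists e; rewrite ei hde eq_sym.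
  by exists d; rewrite di had eq_sym.
have hab : h a != h b by rewrite had eq_sym.
have ab : a != b by apply: contraNneq hab => ->.
have abc := congruence_collinear h hH a b c ai bi ci hab hca ca nab.
have nac := congruence_noncollinear h hH a b c ai bi ci hab hca ca nab.
have [L bL [La Lb Lc Lc' U]] := move_collinear _ _ _ abc.
set c' := move a b c in Lc' U.
have hc'b : h c' = h b.
  by rewrite /c' (hH _ c a (move_hole a b ai bi nab) ci ai hca) move_left.
have fix_inf : move a b inf = inf.
  by apply: hole_inf; apply: move_hole.
have c'i : c' != inf by rewrite -fix_inf (inj_eq perm_inj).
have : [&& [&& a != c & a != c'], b != c, b != c' & c != c'].
  by move: U; rewrite /= !inE !negb_or andbT -!andbA => /and5P[_ -> -> -> ->].
case/and4P=> /andP[ac ac'] bc bc' cc'.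
have nba : ~~ collinear inf b a by rewrite collinearCr.
have hba : h b != h a by rewrite eq_sym.
have c'b : c' != b by rewrite eq_sym.
(* The line is symmetric in its two pairs: [c'] is to [b] as [c] is to [a]. *)
have nbc' := congruence_noncollinear h hH b a c' bi ai c'i hba hc'b c'b nba.
have line u v w : u \in L -> v \in L -> w \in L -> u != v -> u != w -> v != w ->
    collinear u v w.
  by move=> Lu Lv Lw uv uw vw; apply/collinearP; split; [split | exists L].
have iac' : collinear inf a c'.
  have : collinear a b c' by apply: line.
  by rewrite parity_inf // (negPf nab) (negPf nbc') addbF.
have ncc' : ~~ collinear inf c c'.
  have : collinear a c c' by apply: line.
  rewrite parity_inf // (negPf nac) iac' addbF.
  by case: (collinear inf c c').
(* The outer moves fix [b] and [c] respectively, and [a,c'] exchanges them along [L]. *)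
have loop_b : loop a c' b = c.
  rewrite /loop !permM [move inf a b]move_fix // 1?eq_sym //.
  rewrite (move_line L a c' b c) //; last first.
    by rewrite uniq4 ac' ab ac c'b [c' == c]eq_sym cc' bc.
  by apply: move_fix => //; rewrite collinear_rot.
(* All three moves act along the line [K] through [inf], [a], [c']: the path is [c'], [e'], [inf],
   [c']. *)
have loop_c' : loop a c' c' = c'.
  have [K bK [Ki Ka Kc' Ke]] := move_collinear _ _ _ iac'.
  rewrite /loop !permM; set e' := move inf a c' in Ke *.
  rewrite uniq4 => /and5P[ia ic' ie' _ /andP[ae' ce']].
  rewrite (move_line K a c' e' inf) ?move_right //.
  by rewrite uniq4 ac' ae' ai ce' c'i eq_sym.
have := hH _ _ _ (loop_hole a c') c'i bi hc'b.
by rewrite loop_b loop_c' hc'b hca => /eqP; rewrite (negPf hba).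
Qed.
End Group.
End TwoGraph.
End Designs.

Theorem theoremA (T : finType) (blocks : seq {set T}) (lam : nat) (inf : T) :
  is_2design4 blocks lam -> supersimple blocks -> 2 * lam + 2 < #|T| ->
  [/\ (is_group_set (conway_groupoid blocks inf) ->
         [primitive conway_groupoid blocks inf, on [set: T] | 'P]),
      (regular_two_graph (collinear_triples blocks) ->
         [transitive pi_inf blocks inf, on [set~ inf] | 'P]) &
      (regular_two_graph (collinear_triples blocks) ->
       is_group_set (conway_groupoid blocks inf) ->
         [primitive pi_inf blocks inf, on [set~ inf] | 'P])].
Proof.
move=> design ss large; split.
- exact: (groupoid_primitive T blocks lam).
- exact: (hole_trans T blocks lam).
- exact: (hole_primitive T blocks lam).
Qed.
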